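(* Let $\mathsf G=(A,B,C,D)$ with $\rho(A)<1$. Then $\|\mathcal M_\infty(\mathsf G)\|_{\mathrm{op}}=\|\mathsf G\|_{\mathcal H_2^{\mathrm{op}}}$.
   Context: $\mathcal M_k(\mathsf G):=[D|CB|CAB|\dots|CA^{k-2}B]$ and $\|\mathcal M_\infty(\mathsf G)\|_{\mathrm{op}}:=\lim_{k\to\infty}\|\mathcal M_k(\mathsf G)\|_{\mathrm{op}}$. The transfer function is $\mathsf G(z)=C(zI-A)^{-1}B+D\in\mathbb C^{m\times p}$ and $\|\mathsf G\|_{\mathcal H_2^{\mathrm{op}}}:=\max_{v\in\mathbb R^m,\|v\|_2=1}\sqrt{\frac1{2\pi}\int_0^{2\pi}\|v^\top\mathsf G(e^{i\theta})\|_2^2d\theta}$. *)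

(* Defs.v *)
From mathcomp Require Import all_boot all_order all_algebra.
From mathcomp Require Import all_classical all_reals all_analysis.
From mathcomp Require Import complex.
Import Order.TTheory GRing.Theory Num.Theory.
Local Open Scope ring_scope.
Local Open Scope classical_set_scope.

Set Implicit Arguments.
Unset Strict Implicit.
Unset Printing Implicit Defensive.

Section Defs.
Variable R : realType.

Definition cplx_mx (k l : nat) (M : 'M[R]_(k, l)) : 'M[R[i]]_(k, l) :=
  map_mx (fun x : R => Complex x 0) M.

Definition cmod (z : R[i]) : R := Num.sqrt (complex.Re z ^+ 2 + complex.Im z ^+ 2).

(* Spectral radius: the largest modulus of a (complex) eigenvalue of A
   (0 if there are none, i.e. n = 0). *)
Definition spectral_radius (n : nat) (A : 'M[R]_n) : R :=
  sup [set cmod z | z in [set z : R[i] | eigenvalue (cplx_mx A) z]].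

Definition vnorm (k : nat) (x : 'cV[R]_k) : R := Num.sqrt (\sum_i x i 0 ^+ 2).

Definition rvnorm (k : nat) (x : 'rV[R]_k) : R := Num.sqrt (\sum_j x 0 j ^+ 2).

Definition opnorm (k l : nat) (M : 'M[R]_(k, l)) : R :=
  sup [set vnorm (M *m x) | x in [set x : 'cV[R]_l | vnorm x <= 1]].

Definition Mk (n m p : nat) (A : 'M[R]_n) (B : 'M[R]_(n, p))
    (C : 'M[R]_(m, n)) (D : 'M[R]_(m, p)) (k : nat)
    : 'M[R]_(m, \sum_(j < k) p) :=
  \mxrow_(j < k) (if (j : nat) == 0%N then D else C *m A ^+ (j.-1) *m B).

Definition transfer (n m p : nat) (A : 'M[R]_n) (B : 'M[R]_(n, p))
    (C : 'M[R]_(m, n)) (D : 'M[R]_(m, p)) (z : R[i]) : 'M[R[i]]_(m, p) :=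
  cplx_mx C *m invmx (z%:M - cplx_mx A) *m cplx_mx B + cplx_mx D.

Definition expi (t : R) : R[i] := Complex (cos t) (sin t).

Definition h2_integrand (n m p : nat) (A : 'M[R]_n) (B : 'M[R]_(n, p))
    (C : 'M[R]_(m, n)) (D : 'M[R]_(m, p)) (v : 'cV[R]_m) (t : R) : R :=
  let w := (cplx_mx v)^T *m transfer A B C D (expi t) in
  \sum_j (complex.Re (w 0 j) ^+ 2 + complex.Im (w 0 j) ^+ 2).

Definition h2opnorm (n m p : nat) (A : 'M[R]_n) (B : 'M[R]_(n, p))
    (C : 'M[R]_(m, n)) (D : 'M[R]_(m, p)) : R :=
  sup [set Num.sqrt ((2 * pi)^-1 *
          \int[lebesgue_measure]_(t in `[0, 2 * pi]) h2_integrand A B C D v t)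
      | v in [set v : 'cV[R]_m | vnorm v = 1]].

End Defs.

(* Main.v *)
Require Import Defs.
From mathcomp Require Import all_boot all_order all_algebra.
From mathcomp Require Import all_classical all_reals all_analysis.
From mathcomp Require Import measurable_realfun complex ring lra.
Import Order.TTheory GRing.Theory Num.Theory.
Import numFieldNormedType.Exports.
Local Open Scope ring_scope.
Local Open Scope classical_set_scope.

Set Implicit Arguments.
Unset Strict Implicit.
Unset Printing Implicit Defensive.

(** By Cayley-Hamilton the product of the [A - l] over the eigenvalues [l] of [A]
    vanishes, and since every [|l| < 1], each factor can be stripped off while
    keeping the entries of the powers of [A] absolutely summable.  Hence
    [v^T G(e^(it))] is the sum of its Fourier series, whose coefficients are
    [v^T D] and [v^T C A^k B]; the mean square of the partial sums is computed
    from an explicit primitive, and dominated convergence gives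
    [|v^T M_N| --> (1/2pi \int |v^T G|^2)^(1/2)], increasingly in [N].  The
    operator norm of [M_N] being the supremum of [|v^T M_N|] over unit vectors
    [v], the theorem is an exchange of the suprema over [v] and [N]. *)

(** * Euclidean norms, and the operator norm by duality with linear forms *)

Section Norms.
Variable R : realType.

Lemma cauchy_schwarz (k : nat) (a b : 'I_k -> R) :
  (\sum_i a i * b i) ^+ 2 <= (\sum_i a i ^+ 2) * (\sum_i b i ^+ 2).
Proof.
(* Lagrange's identity *)
have : 0 <= \sum_i \sum_j (a i * b j - a j * b i) ^+ 2.
  by apply: sumr_ge0 => i _; apply: sumr_ge0 => j _; exact: sqr_ge0.
have -> : \sum_i \sum_j (a i * b j - a j * b i) ^+ 2 =
    (\sum_i a i ^+ 2) * (\sum_i b i ^+ 2) + (\sum_i b i ^+ 2) * (\sum_i a i ^+ 2)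
    - ((\sum_i a i * b i) * (\sum_i a i * b i)) *+ 2.
  rewrite !big_distrlr /= -!big_split /= -sumrMnl -sumrB.
  apply: eq_bigr => i _; rewrite -!big_split /= -sumrMnl -sumrB.
  by apply: eq_bigr => j _; ring.
by rewrite expr2; lra.
Qed.

Lemma vnorm_ge0 (k : nat) (x : 'cV[R]_k) : 0 <= vnorm x.
Proof. exact: sqrtr_ge0. Qed.

Lemma sumsq_ge0 (k : nat) (a : 'I_k -> R) : 0 <= \sum_i a i ^+ 2.
Proof. by apply: sumr_ge0 => i _; exact: sqr_ge0. Qed.

Lemma rvnormE (k : nat) (y : 'rV[R]_k) : rvnorm y = vnorm y^T.
Proof. by congr Num.sqrt; apply: eq_bigr => i _; rewrite mxE. Qed.

Lemma sqr_vnorm (k : nat) (x : 'cV[R]_k) : vnorm x ^+ 2 = (x^T *m x) 0 0.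
Proof.
rewrite sqr_sqrtr ?sumsq_ge0// mxE; apply: eq_bigr => i _.
by rewrite mxE expr2.
Qed.

Lemma dot_le_vnorm (k : nat) (x y : 'cV[R]_k) :
  (x^T *m y) 0 0 <= vnorm x * vnorm y.
Proof.
rewrite -sqrtrM ?sumsq_ge0//; apply: le_trans (ler_norm _) _.
rewrite -sqrtr_sqr ler_sqrt ?mulr_ge0 ?sumsq_ge0//.
rewrite mxE; under eq_bigr do rewrite mxE.
exact: cauchy_schwarz.
Qed.

Lemma vnormZ (k : nat) (c : R) (x : 'cV[R]_k) : vnorm (c *: x) = `|c| * vnorm x.
Proof.
rewrite /vnorm -sqrtr_sqr -sqrtrM ?sqr_ge0//; congr Num.sqrt.
by rewrite big_distrr; apply: eq_bigr => i _; rewrite mxE exprMn.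
Qed.

Lemma vnorm0 (k : nat) : vnorm (0 : 'cV[R]_k) = 0.
Proof. by rewrite -(scale0r 0) vnormZ normr0 mul0r. Qed.

Lemma vnorm_normalize (k : nat) (x : 'cV[R]_k) :
  vnorm x != 0 -> vnorm ((vnorm x)^-1 *: x) = 1.
Proof.
by move=> x0; rewrite vnormZ ger0_norm ?invr_ge0 ?vnorm_ge0// mulVf.
Qed.

(* A nonzero vector is normed by its dual unit vector, so it is enough to bound
   the linear forms [v^T M] over the unit sphere. *)
Lemma vnorm_mulmx_le (k l : nat) (M : 'M[R]_(k, l)) (x : 'cV[R]_l) (b : R) :
  0 <= b -> (forall v : 'cV[R]_k, vnorm v = 1 -> rvnorm (v^T *m M) <= b) ->
  vnorm (M *m x) <= b * vnorm x.
Proof.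
move=> b0 Mb; have [->|Mx0] := eqVneq (vnorm (M *m x)) 0.
  by rewrite mulr_ge0// vnorm_ge0.
have /Mb vM := vnorm_normalize Mx0; set v := _ *: _ in vM.
have -> : vnorm (M *m x) = (v^T *m (M *m x)) 0 0.
  rewrite /v linearZ /= -scalemxAl mxE -sqr_vnorm expr2 mulrA mulVf//.
  by rewrite mul1r.
rewrite mulmxA -[v^T *m M]trmxK (le_trans (dot_le_vnorm _ _))//.
by rewrite ler_wpM2r ?vnorm_ge0// -rvnormE.
Qed.

Lemma opnorm_le (k l : nat) (M : 'M[R]_(k, l)) (b : R) :
  0 <= b -> (forall v : 'cV[R]_k, vnorm v = 1 -> rvnorm (v^T *m M) <= b) ->
  opnorm M <= b.
Proof.
move=> b0 Mb; apply: ge_sup.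
  by exists (vnorm (M *m 0)), 0 => //=; rewrite vnorm0.
move=> _ [x /= x1 <-]; apply: le_trans (vnorm_mulmx_le _ b0 Mb) _.
by rewrite ler_piMr.
Qed.

Lemma sqr_mulmx_le_col (k l : nat) (M : 'M[R]_(k, l)) (v : 'cV[R]_k) (j : 'I_l) :
  vnorm v = 1 -> (v^T *m M) 0 j ^+ 2 <= \sum_i M i j ^+ 2.
Proof.
move=> v1; rewrite mxE; apply: le_trans (cauchy_schwarz _ _) _.
have -> : \sum_i v^T 0 i ^+ 2 = 1.
  rewrite -(expr1n R 2) -v1 sqr_sqrtr ?sumsq_ge0//.
  by apply: eq_bigr => i _; rewrite mxE.
by rewrite mul1r.
Qed.

(** Serves to bound the set whose [sup] is [opnorm M], so that [opnorm M] is a true least upper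
    bound; the size of the bound is irrelevant. *)
Lemma rvnorm_mulmx_le_frobenius (k l : nat) (M : 'M[R]_(k, l)) (v : 'cV[R]_k) :
  vnorm v = 1 ->
  rvnorm (v^T *m M) <= Num.sqrt (\sum_j \sum_i M i j ^+ 2).
Proof.
move=> v1; rewrite ler_sqrt; last by apply: sumr_ge0 => j _; exact: sumsq_ge0.
by apply: ler_sum => j _; exact: sqr_mulmx_le_col.
Qed.

Lemma le_opnorm (k l : nat) (M : 'M[R]_(k, l)) (x : 'cV[R]_l) :
  vnorm x <= 1 -> vnorm (M *m x) <= opnorm M.
Proof.
move=> x1; apply: ub_le_sup; last by exists x.
exists (Num.sqrt (\sum_j \sum_i M i j ^+ 2)) => _ [y /= y1 <-].
have := vnorm_mulmx_le y (sqrtr_ge0 _) (@rvnorm_mulmx_le_frobenius _ _ M).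
by move=> /le_trans; apply; rewrite ler_piMr// sqrtr_ge0.
Qed.

Lemma opnorm_ge0 (k l : nat) (M : 'M[R]_(k, l)) : 0 <= opnorm M.
Proof. by apply: le_trans (vnorm_ge0 _) (@le_opnorm _ _ _ 0 _); rewrite vnorm0. Qed.

(** With [y = (v^T M)^T], testing [M] on the unit vector [y / |y|] gives [|y| = v^T (M (y / |y|))],
    and Cauchy-Schwarz with [|v| = 1] concludes. This is the converse half of the duality begun in
    [opnorm_le]. *)
Lemma rvnorm_le_opnorm (k l : nat) (M : 'M[R]_(k, l)) (v : 'cV[R]_k) :
  vnorm v = 1 -> rvnorm (v^T *m M) <= opnorm M.
Proof.
move=> v1; rewrite rvnormE; set y := _^T.
have [->|y0] := eqVneq (vnorm y) 0; first exact: opnorm_ge0.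
have := @le_opnorm _ _ M ((vnorm y)^-1 *: y); rewrite vnorm_normalize// => /(_ (lexx _)).
apply: le_trans.
have yE : vnorm y = (v^T *m (M *m ((vnorm y)^-1 *: y))) 0 0.
  rewrite mulmxA -scalemxAr mxE -[v^T *m M]trmxK -/y -sqr_vnorm.
  by rewrite expr2 mulrA mulVf// mul1r.
by rewrite {1}yE (le_trans (dot_le_vnorm _ _))// v1 mul1r.
Qed.

End Norms.

(** * Absolutely summable complex sequences and the powers of a matrix *)

Section AbsolutelySummable.
Variable R : realType.
Implicit Types (u v : nat -> R[i]).

Lemma cmodE (z : R[i]) : cmod z = Normc.normc z.
Proof. by case: z. Qed.

Lemma cmodM (x y : R[i]) : cmod (x * y) = cmod x * cmod y.
Proof. by rewrite !cmodE Normc.normcM. Qed.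

Lemma cmodD (x y : R[i]) : cmod (x + y) <= cmod x + cmod y.
Proof. by rewrite !cmodE; exact: le_normcD. Qed.

Lemma cmod_ge0 (z : R[i]) : 0 <= cmod z.
Proof. exact: sqrtr_ge0. Qed.

Lemma cmod0 : cmod (0 : R[i]) = 0.
Proof. by rewrite cmodE Normc.normc0. Qed.

Lemma cmod_real (x : R) : cmod (Complex x 0) = `|x|.
Proof. by rewrite /cmod /= expr0n addr0 sqrtr_sqr. Qed.

Lemma Re_le_cmod (z : R[i]) : `|complex.Re z| <= cmod z.
Proof. by rewrite -sqrtr_sqr ler_sqrt ?addr_ge0 ?sqr_ge0// lerDl sqr_ge0. Qed.

Lemma Im_le_cmod (z : R[i]) : `|complex.Im z| <= cmod z.
Proof. by rewrite -sqrtr_sqr ler_sqrt ?addr_ge0 ?sqr_ge0// lerDr sqr_ge0. Qed.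

(** Stated through bounded partial sums, so that the closure properties only involve finite sums. *)
Definition abs_summable u := exists M, forall N, \sum_(k < N) cmod (u k) <= M.

Lemma abs_summable_le u v :
  (forall k, cmod (u k) <= cmod (v k)) -> abs_summable v -> abs_summable u.
Proof.
move=> uv [M vM]; exists M => N; apply: le_trans (vM N).
by apply: ler_sum => k _; exact: uv.
Qed.

Lemma abs_summable0 : abs_summable (fun=> 0).
Proof. by exists 0 => N; rewrite big1// => k _; rewrite cmod0. Qed.

Lemma abs_summableD u v :
  abs_summable u -> abs_summable v -> abs_summable (fun k => u k + v k).
Proof.
move=> [M uM] [M' vM']; exists (M + M') => N; apply: le_trans (lerD (uM N) (vM' N)).
by rewrite -big_split; apply: ler_sum => k _; exact: cmodD.
Qed.

Lemma abs_summableZ (c : R[i]) u :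
  abs_summable u -> abs_summable (fun k => c * u k).
Proof.
move=> [M uM]; exists (cmod c * M) => N.
under eq_bigr do rewrite cmodM.
by rewrite -big_distrr ler_wpM2l ?cmod_ge0.
Qed.

Lemma abs_summable_sum (I : finType) (u : I -> nat -> R[i]) :
  (forall i, abs_summable (u i)) -> abs_summable (fun k => \sum_i u i k).
Proof.
move=> us; elim: (index_enum I) => [|i r IHr].
  by apply: abs_summable_le abs_summable0 => k; rewrite big_nil.
apply: abs_summable_le (abs_summableD (us i) IHr) => k.
by rewrite big_cons.
Qed.

Lemma abs_summable_mulmx (m n p q : nat) (L : 'M[R[i]]_(m, n))
    (X : nat -> 'M[R[i]]_(n, p)) (Y : 'M[R[i]]_(p, q)) :
  (forall i j, abs_summable (fun k => X k i j)) ->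
  forall i j, abs_summable (fun k => (L *m X k *m Y) i j).
Proof.
move=> Xs i j.
have : abs_summable (fun k => \sum_b Y b j * \sum_a L i a * X k a b).
  by do 2![apply: abs_summable_sum => ?; apply: abs_summableZ].
apply: abs_summable_le => k; rewrite mxE le_eqVlt; apply/orP; left; apply/eqP.
by congr cmod; apply: eq_bigr => b _; rewrite mxE mulrC.
Qed.

Lemma abs_summable_shift u :
  abs_summable (fun k => u k.+1) -> abs_summable u.
Proof.
move=> [M uM]; exists (cmod (u 0%N) + M) => -[|N].
  by rewrite big_ord0 addr_ge0 ?cmod_ge0//; have := uM 0%N; rewrite big_ord0.
by rewrite big_ord_recl lerD2l; exact: uM.
Qed.

(** A bound [M] on the partial sums also bounds each term, so [|u k|^2 <= M * |u k|]. *)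
Lemma abs_summable_sqr u : abs_summable u ->
  exists M, forall N, \sum_(k < N) cmod (u k) ^+ 2 <= M.
Proof.
move=> [M uM]; exists (M * M) => N.
have M0 : 0 <= M by have := uM 0%N; rewrite big_ord0.
apply: le_trans (ler_wpM2l M0 (uM N)); rewrite big_distrr; apply: ler_sum => k _.
rewrite expr2 ler_wpM2r ?cmod_ge0//; apply: le_trans (uM k.+1).
rewrite big_ord_recr /= lerDr; apply: sumr_ge0 => i _; exact: cmod_ge0.
Qed.

Lemma abs_summable_cvg0 u :
  abs_summable u -> (cmod (u k) : R^o) @[k --> \oo] --> (0 : R^o).
Proof.
move=> [M uM]; apply: cvg_series_cvg_0; apply: nondecreasing_is_cvgn.
  apply: nondecreasing_series => k _ _; exact: cmod_ge0.
by exists M => _ [N _ <-]; rewrite /series /= big_mkord; exact: uM.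
Qed.

(* With [S_N := \sum_(k < N) |u k|], the hypothesis gives
   [S_N <= |u 0| + M + |l| * S_N]. *)
Lemma abs_summable_recurrence (l : R[i]) u :
  cmod l < 1 -> abs_summable (fun k => u k.+1 - l * u k) -> abs_summable u.
Proof.
move=> l1 [M yM]; exists ((cmod (u 0%N) + M) / (1 - cmod l)) => N.
rewrite ler_pdivlMr ?subr_gt0// mulrBr mulr1 lerBlDr.
set S := \sum_(k < N) _.
(* The sum of [N.+1] moduli, peeled once at its last term and once at its first. *)
have : S + cmod (u N) = cmod (u 0%N) + \sum_(k < N) cmod (u k.+1).
  by rewrite -(big_ord_recr N (fun k : 'I_N.+1 => cmod (u k))) big_ord_recl.
have : \sum_(k < N) cmod (u k.+1) <= M + S * cmod l.
  apply: le_trans (lerD (yM N) (lexx _)); rewrite mulrC big_distrr -big_split /=.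
  apply: ler_sum => k _; rewrite -cmodM.
  by apply: le_trans (cmodD _ _); rewrite subrK.
by have := cmod_ge0 (u N); lra.
Qed.

(** Induction on [s]: if [Y] is the product over the tail times [X], then
    [A^k (A - z) Y = A^(k+1) Y - z A^k Y], so [abs_summable_recurrence] strips the factor of [z]
    entrywise. *)
Lemma abs_summable_expmx_prod (n q : nat) (A : 'M[R[i]]_n.+1) (s : seq R[i])
    (X : 'M[R[i]]_(n.+1, q)) :
  (forall z, z \in s -> cmod z < 1) ->
  (forall i j, abs_summable
     (fun k => (A ^+ k *m (\prod_(z <- s) (A - z%:M) *m X)) i j)) ->
  forall i j, abs_summable (fun k => (A ^+ k *m X) i j).
Proof.
elim: s => [|z s IHs] s1 sAX.
  by move: sAX; rewrite big_nil mul1mx.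
apply: IHs => [y ys|i j]; first by rewrite s1// inE ys orbT.
apply: (@abs_summable_recurrence z); first by rewrite s1// mem_head.
apply: abs_summable_le (sAX i j) => k; rewrite big_cons.
rewrite -mulmxE -mulmxA; set Y := _ *m X; rewrite mulmxBl mulmxBr mul_scalar_mx.
rewrite -scalemxAr exprSr -mulmxE -mulmxA.
by rewrite [in leRHS]mxE [X in _ <= cmod (_ + X)]mxE [X in _ <= cmod (_ - X)]mxE lexx.
Qed.

Lemma abs_summable_expmx (n : nat) (A : 'M[R[i]]_n) :
  (forall z, eigenvalue A z -> cmod z < 1) ->
  forall i j, abs_summable (fun k => (A ^+ k) i j).
Proof.
case: n A => [A _ []//|n A A1].
have [s ps] := closed_field_poly_normal (char_poly A).
move: (ps); rewrite (monicP (char_poly_monic A)) scale1r => charA.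
move=> i j; apply: (@abs_summable_le _ (fun k => (A ^+ k *m 1%:M) i j)) => [k|].
  by rewrite mulmx1.
apply: (@abs_summable_expmx_prod _ _ _ s) => [z zs|{}i {}j].
  by apply: A1; rewrite eigenvalue_root_char charA root_prod_XsubC.
rewrite mulmx1.
have -> : \prod_(z <- s) (A - z%:M) = horner_mx A (char_poly A).
  rewrite charA rmorph_prod; apply: eq_bigr => z _.
  by rewrite rmorphB /= horner_mx_X horner_mx_C.
rewrite Cayley_Hamilton; apply: abs_summable_le abs_summable0 => k.
by rewrite mulmx0 mxE.
Qed.

Lemma cplx_mxM (m n p : nat) (X : 'M[R]_(m, n)) (Y : 'M[R]_(n, p)) :
  cplx_mx (X *m Y) = cplx_mx X *m cplx_mx Y.
Proof. exact: (map_mxM (real_complex R)). Qed.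

Lemma cplx_mxX (n : nat) (A : 'M[R]_n) (k : nat) :
  cplx_mx (A ^+ k) = cplx_mx A ^+ k.
Proof.
elim: k => [|k IHk]; first exact: (map_mx1 (real_complex R)).
by rewrite !exprS -!mulmxE cplx_mxM IHk.
Qed.

Lemma eigenvalue_le_spectral_radius (n : nat) (A : 'M[R]_n) (z : R[i]) :
  eigenvalue (cplx_mx A) z -> cmod z <= spectral_radius A.
Proof.
move=> Az; apply: ub_le_sup; last by exists z.
have [s ps] := closed_field_poly_normal (char_poly (cplx_mx A)).
move: (ps); rewrite (monicP (char_poly_monic _)) scale1r => charA.
(* Eigenvalues are among the finitely many roots [s] of the characteristic polynomial; the sum of
   all their moduli dominates each one. *)
exists (\sum_(y <- s) cmod y) => _ [y /= Ay <-].
move: Ay; rewrite eigenvalue_root_char charA root_prod_XsubC => ys.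
rewrite (big_rem y)//= lerDl; apply: sumr_ge0 => x _; exact: cmod_ge0.
Qed.

End AbsolutelySummable.

(** * The resolvent on the unit circle *)

Section Resolvent.
Variable R : realType.

(** The Neumann series with exact remainder: [V = (z - A)^-1] satisfies [V = z^-1 (1 + A V)], which
    is substituted into itself [N] times. *)
Lemma resolvent_expansion (n : nat) (A : 'M[R[i]]_n) (z : R[i]) (N : nat) :
  z != 0 -> z%:M - A \in unitmx ->
  invmx (z%:M - A) = \sum_(k < N) z^-1 ^+ k.+1 *: A ^+ k
    + z^-1 ^+ N *: (A ^+ N *m invmx (z%:M - A)).
Proof.
move=> z0 zA; elim: N => [|N IHN].
  by rewrite big_ord0 add0r expr0 scale1r expr0 mul1mx.
have AV : A *m invmx (z%:M - A) = z *: invmx (z%:M - A) - 1%:M.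
  by rewrite -[X in X *m _ = _](subKr z%:M A) mulmxBl mulmxV// mul_scalar_mx.
rewrite {1}IHN big_ord_recr /= -addrA; congr (_ + _).
have -> : A ^+ N *m invmx (z%:M - A) =
    z^-1 *: (A ^+ N + A ^+ N.+1 *m invmx (z%:M - A)).
  rewrite exprSr -mulmxE -mulmxA AV mulmxBr mulmx1 addrCA subrr addr0.
  by rewrite -scalemxAr scalerA mulVf// scale1r.
by rewrite scalerA -exprSr scalerDr.
Qed.

Lemma expiN (t : R) : expi (- t) = (expi t)^-1.
Proof.
have tt : expi (- t) * expi t = 1.
  apply/eqP; rewrite eq_complex /= cosN sinN; apply/andP; split; apply/eqP.
    by rewrite mulNr opprK -!expr2 cos2Dsin2.
  by ring.
rewrite -[LHS]mulr1 -(mulfV (_ : expi t != 0)) ?mulrA ?tt ?mul1r//.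
by apply/eqP => t0; move: tt => /eqP; rewrite t0 mulr0 eq_sym oner_eq0.
Qed.

Lemma expi_neq0 (t : R) : expi t != 0.
Proof.
rewrite -invr_eq0 -expiN eq_complex /= cosN sinN oppr_eq0; apply/negP.
move=> /andP[/eqP c0 /eqP s0]; have /eqP := cos2Dsin2 t.
by rewrite c0 s0 expr0n addr0 eq_sym oner_eq0.
Qed.

Lemma cmod_expi (t : R) : cmod (expi t) = 1.
Proof. by rewrite /cmod /= cos2Dsin2 sqrtr1. Qed.

Lemma expiX (t : R) (k : nat) : expi t ^+ k = expi (k%:R * t).
Proof.
elim: k => [|k IHk]; first by rewrite mul0r /expi cos0 sin0.
rewrite exprSr IHk -addn1 natrD mulrDl mul1r /expi cosD sinD.
by congr Complex; rewrite addrC.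
Qed.

Lemma cmod_expiVX (t : R) (k : nat) : cmod ((expi t)^-1 ^+ k) = 1.
Proof. by rewrite -expiN expiX cmod_expi. Qed.

End Resolvent.

(** * Mean squares of trigonometric polynomials over a period *)

Section Parseval.
Variable R : realType.
Implicit Types (f g : R -> R) (a b : R).

(* [f] is continuous with integral [a] over a period, witnessed by a primitive. *)
Definition period_integral f a := (continuous f) /\
  exists2 F : R -> R, (forall x : R, is_derive x 1 F (f x)) &
    F (2 * pi) - F 0 = a.

Lemma period_integralE f a : period_integral f a ->
  (\int[lebesgue_measure]_(t in `[0%R, (2 * pi)%R]) (f t)%:E)%E = a%:E.
Proof.
move=> [cf [F dF <-]].
have Fc : continuous F.
  move=> x; apply: differentiable_continuous; apply/derivable1_diffP.
  by case: (dF x).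
rewrite (@continuous_FTC2 _ _ F)//.
- by rewrite mulr_gt0// pi_gt0.
- exact: continuous_subspaceT.
- split=> [x _||]; first by case: (dF x).
  + exact/cvg_at_right_filter/Fc.
  + exact/cvg_at_left_filter/Fc.
- by move=> x _; rewrite derive1E; apply: derive_val.
Qed.

Lemma period_integral_ext f g a : f =1 g -> period_integral f a ->
  period_integral g a.
Proof. by move=> /funext ->. Qed.

Lemma period_integralD f g a b : period_integral f a -> period_integral g b ->
  period_integral (fun t => f t + g t) (a + b).
Proof.
move=> [cf [F dF Fa]] [cg [G dG Gb]]; split.
  by move=> x; apply: cvgD; [exact: cf|exact: cg].
exists (F \+ G); last by rewrite /= -Fa -Gb; ring.
by move=> x; apply: is_deriveD.
Qed.

Lemma period_integralZ (c : R) f a : period_integral f a ->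
  period_integral (fun t => c * f t) (c * a).
Proof.
move=> [cf [F dF Fa]]; split.
  by move=> x; apply: cvgM; [exact: cvg_cst|exact: cf].
exists (c \*: F); last by rewrite /= -Fa mulrBr.
by move=> x; apply: is_deriveZ.
Qed.

Lemma period_integral_cst (c : R) : period_integral (fun=> c) (2 * pi * c).
Proof.
split; first by move=> x; exact: cvg_cst.
exists (c \*: id); last by rewrite /= scaler0 subr0 [LHS]mulrC.
by move=> x; apply: is_derive_eq; rewrite [LHS]mulr1.
Qed.

Lemma period_integral_sum (I : finType) (f : I -> R -> R) (a : I -> R) :
  (forall i, period_integral (f i) (a i)) ->
  period_integral (fun t => \sum_i f i t) (\sum_i a i).
Proof.
move=> fa; elim: (index_enum I) => [|i r IHr].
  have := period_integral_cst 0; rewrite mulr0 big_nil.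
  by apply: period_integral_ext => t; rewrite big_nil.
rewrite big_cons; apply: period_integral_ext (period_integralD (fa i) IHr) => t.
by rewrite big_cons.
Qed.

Lemma sin_natmul2pi (k : nat) : sin (k%:R * (2 * pi)) = 0 :> R.
Proof.
(* The addition formula for [sin] involves the cosine, so the induction carries both values. *)
suff : sin (k%:R * (2 * pi)) = 0 :> R /\ cos (k%:R * (2 * pi)) = 1 :> R by case.
elim: k => [|k [IHs IHc]]; first by rewrite mul0r sin0 cos0.
rewrite -addn1 natrD mulrDl mul1r sinD cosD IHs IHc.
have -> : 2 * pi = pi *+ 2 :> R by rewrite mulr_natl.
by rewrite sin2pi cos2pi; split; ring.
Qed.

Lemma period_integral_cos (k : nat) : (0 < k)%N ->
  period_integral (fun t => cos (k%:R * t)) 0.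
Proof.
move=> k0; have k1 : k%:R != 0 :> R by rewrite pnatr_eq0 -lt0n.
split.
  move=> x; have kx : (k%:R * t : R^o) @[t --> (x : R^o)] --> (k%:R * x : R^o).
    by apply: cvgM; [exact: cvg_cst|exact: cvg_id].
  exact: (cvg_comp _ _ kx (@continuous_cos _ _)).
(* The primitive [sin (k t) / k] vanishes at both ends of the period. *)
exists (k%:R^-1 \*: (sin \o (k%:R \*: (@id R)))).
  move=> x; apply: is_derive_eq.
  rewrite [_%:A]mulr1 [_ \*: id]/= [LHS]mulrC mulfK//.
have -> : (k%:R^-1 \*: (sin \o (k%:R \*: (@id R)))) (2 * pi) =
    k%:R^-1 * sin (k%:R * (2 * pi)) by [].
by rewrite sin_natmul2pi /= scaler0 sin0 !mulr0 scaler0 subrr.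
Qed.

(** The integrand is the squared modulus of the sum of the [g k * e^(ikt)]. Adding the term of index
    [N] contributes [g N ^+ 2] and a cross term in the [cos ((N - k) t)] with [k < N], whose
    integral is zero. *)
Lemma period_integral_trig (g : nat -> R) (N : nat) :
  period_integral
    (fun t => (\sum_(k < N) g k * cos (k%:R * t)) ^+ 2
            + (\sum_(k < N) g k * sin (k%:R * t)) ^+ 2)
    (2 * pi * \sum_(k < N) g k ^+ 2).
Proof.
elim: N => [|N IHN].
  rewrite big_ord0 ; apply: period_integral_ext (period_integral_cst 0) => t.
  by rewrite !big_ord0 expr0n addr0.
have cross : period_integral
    (fun t => 2 * g N * \sum_(k < N) g k * cos ((N - k)%:R * t)) 0.
  rewrite -[X in period_integral _ X](mulr0 (2 * g N)).
  apply: period_integralZ.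
  rewrite [X in period_integral _ X](_ : _ = \sum_(k < N) g k * 0); last first.
    by rewrite big1// => k _; rewrite mulr0.
  apply: (@period_integral_sum _ (fun (k : 'I_N) t => g k * cos ((N - k)%:R * t))).
  move=> k; apply: period_integralZ.
  by apply: period_integral_cos; rewrite subn_gt0.
rewrite big_ord_recr /= mulrDr -[X in period_integral _ X]addr0.
apply: (period_integral_ext _ (period_integralD
  (period_integralD IHN (period_integral_cst (g N ^+ 2))) cross)) => t.
rewrite !big_ord_recr /=.
have -> : \sum_(k < N) g k * cos ((N - k)%:R * t) =
    cos (N%:R * t) * (\sum_(k < N) g k * cos (k%:R * t)) +
    sin (N%:R * t) * (\sum_(k < N) g k * sin (k%:R * t)).
  rewrite !big_distrr -big_split; apply: eq_bigr => k _ /=.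
  by rewrite natrB 1?ltnW// mulrBl cosB; ring.
set X := \sum_(k < N) _ * cos _; set Y := \sum_(k < N) _ * sin _.
(* Reinserting [cos^2 + sin^2 = 1] turns the goal into a polynomial identity. *)
have -> : g N ^+ 2 = g N ^+ 2 * (cos (N%:R * t) ^+ 2 + sin (N%:R * t) ^+ 2).
  by rewrite cos2Dsin2 mulr1.
ring.
Qed.

End Parseval.

(** * Fourier series of the transfer function and the limit of [|v^T M_N|] *)

Section System.
Variables (R : realType) (n m p : nat).
Variables (A : 'M[R]_n) (B : 'M[R]_(n, p)) (C : 'M[R]_(m, n)) (D : 'M[R]_(m, p)).
Hypothesis rhoA : spectral_radius A < 1.

(** Both the block of index [k] in [Mk] and the coefficient of [z^-k] in the expansion of the
    transfer function at infinity. *)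
Definition markov_parameter (k : nat) : 'M[R]_(m, p) :=
  if k == 0%N then D else C *m A ^+ k.-1 *m B.

Let gain (v : 'cV[R]_m) (j : 'I_p) (k : nat) : R := (v^T *m markov_parameter k) 0 j.

Lemma abs_summable_cplx_expmx (i j : 'I_n) :
  abs_summable (fun k => (cplx_mx A ^+ k) i j).
Proof.
apply: abs_summable_expmx => z Az.
exact: le_lt_trans (eigenvalue_le_spectral_radius Az) rhoA.
Qed.

Lemma abs_summable_markov_parameter (i : 'I_m) (j : 'I_p) :
  abs_summable (fun k => cplx_mx (markov_parameter k) i j).
Proof.
(* Dropping the term [D] at index 0 leaves the sequence [C A^k B]. *)
apply: abs_summable_shift.
have := abs_summable_mulmx (cplx_mx C) (cplx_mx B) abs_summable_cplx_expmx i j.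
by apply: abs_summable_le => k; rewrite /markov_parameter /= !cplx_mxM cplx_mxX.
Qed.

Lemma abs_summable_gain (v : 'cV[R]_m) (j : 'I_p) :
  abs_summable (fun k => Complex (gain v j k) 0).
Proof.
have := abs_summable_mulmx (cplx_mx v^T) 1%:M abs_summable_markov_parameter 0 j.
by apply: abs_summable_le => k; rewrite mulmx1 -cplx_mxM [X in _ <= cmod X]mxE.
Qed.

Lemma sqr_rvnorm_Mk (v : 'cV[R]_m) (N : nat) :
  rvnorm (v^T *m Mk A B C D N) ^+ 2 = \sum_j \sum_(k < N) gain v j k ^+ 2.
Proof.
rewrite rvnormE sqr_vnorm trmxK /Mk mul_mxrow tr_mxrow mul_mxrow_mxcol summxE.
rewrite exchange_big /=; apply: eq_bigr => k _; rewrite mxE.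
by apply: eq_bigr => j _; rewrite [X in _ * X]mxE -expr2.
Qed.

(** Otherwise [expi t] would be an eigenvalue of modulus 1. Hence the [invmx] in [transfer] is a
    genuine inverse along the whole circle. *)
Lemma unitmx_expi_sub (t : R) : (expi t)%:M - cplx_mx A \in unitmx.
Proof.
apply: contraT => tA; suff : eigenvalue (cplx_mx A) (expi t).
  by move=> /eigenvalue_le_spectral_radius; rewrite cmod_expi leNgt rhoA.
rewrite /eigenvalue /eigenspace kermx_eq0 row_free_unit.
by apply: contra tA => tA; rewrite -opprB -scaleN1r unitmxZ// unitrN1.
Qed.

(** By [resolvent_expansion], the remainder after [N.+1] terms is [z^-N v^T C A^N (z - A)^-1 B];
    since [|z| = 1], its modulus is that of a term of an absolutely summable sequence. *)
Lemma transfer_cvg (v : 'cV[R]_m) (j : 'I_p) (t : R) :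
  let w := (cplx_mx v)^T *m transfer A B C D (expi t) in
  (cmod (w 0 j - \sum_(k < N) (expi t)^-1 ^+ k * Complex (gain v j k) 0) : R^o)
    @[N --> \oo] --> (0 : R^o).
Proof.
(* [N] terms of the resolvent together with [D] make [N.+1] Markov terms. *)
move=> w; rewrite -cvg_shiftS.
set z := expi t; set Rz := invmx (z%:M - cplx_mx A).
have /abs_summable_cvg0 := abs_summable_mulmx ((cplx_mx v)^T *m cplx_mx C)
  (Rz *m cplx_mx B) abs_summable_cplx_expmx 0 j.
apply: cvg_trans; apply: near_eq_cvg; apply: nearW => N.
rewrite -[LHS]mul1r -(cmod_expiVX t N) -cmodM; congr cmod; rewrite -/z.
have -> : w = \sum_(k < N.+1) z^-1 ^+ k *: cplx_mx (v^T *m markov_parameter k) +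
    z^-1 ^+ N *: ((cplx_mx v)^T *m cplx_mx C *m cplx_mx A ^+ N *m (Rz *m cplx_mx B)).
  rewrite big_ord_recl /= expr0 scale1r {1}/markov_parameter /= /w /transfer.
  rewrite -/z (resolvent_expansion N (expi_neq0 t) (unitmx_expi_sub t)) -/z -/Rz.
  rewrite mulmxDr addrC -addrA; congr (_ + _); first by rewrite cplx_mxM map_trmx.
  rewrite mulmxDr mulmxDl mulmxDr mulmx_sumr mulmx_suml mulmx_sumr; congr (_ + _).
    apply: eq_bigr => k _; rewrite -scalemxAr -scalemxAl -scalemxAr.
    by rewrite /markov_parameter /= !cplx_mxM cplx_mxX /cplx_mx map_trmx !mulmxA.
  by rewrite -scalemxAr -scalemxAl -scalemxAr !mulmxA.
rewrite [X in _ = X - _]mxE summxE [X in _ = _ + X - _]mxE addrAC.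
rewrite [X in _ = X - _ + _](_ : _ = \sum_(k < N.+1) z^-1 ^+ k * Complex (gain v j k) 0).
  by rewrite subrr add0r.
by apply: eq_bigr => k _; rewrite mxE [X in _ * X = _]mxE.
Qed.

Lemma h2_integrand_cvg (v : 'cV[R]_m) (t : R) :
  (\sum_j ((\sum_(k < N) gain v j k * cos (k%:R * t)) ^+ 2
         + (\sum_(k < N) gain v j k * sin (k%:R * t)) ^+ 2) : R^o)
  @[N --> \oo] --> (h2_integrand A B C D v t : R^o).
Proof.
apply: cvg_big => [|j _]; first exact: add_continuous.
have := transfer_cvg v j t; set w := (_ *m _) 0 j; move=> wP.
pose P N := \sum_(k < N) (expi t)^-1 ^+ k * Complex (gain v j k) 0.
have ReP N : complex.Re (P N) = \sum_(k < N) gain v j k * cos (k%:R * t).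
  rewrite /P raddf_sum; apply: eq_bigr => k _.
  by rewrite -expiN expiX mulrN /= cosN mulr0 subr0 mulrC.
have ImP N : complex.Im (P N) = - \sum_(k < N) gain v j k * sin (k%:R * t).
  rewrite /P raddf_sum -sumrN; apply: eq_bigr => k _.
  by rewrite -expiN expiX mulrN /= sinN mulr0 add0r mulNr mulrC.
(* Real and imaginary parts are additive and dominated by the modulus, so both inherit the
   convergence. *)
have cvgP (f : R[i] -> R) : (forall x y, f (x - y) = f x - f y) ->
    (forall x, `|f x| <= cmod x) -> (f (P N) : R^o) @[N --> \oo] --> (f w : R^o).
  move=> fB fle; apply/cvgrPdist_le => e e0.
  move/cvgrPdist_le : wP => /(_ _ e0); apply: filterS => N.
  by rewrite sub0r normrN -fB ger0_norm ?cmod_ge0//; exact: le_trans.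
(* The frequencies are [-k], hence a minus sign in the imaginary part, which the square absorbs. *)
under eq_fun do rewrite -ReP -[X in _ + X]sqrrN -ImP.
have cRe := cvgP (@complex.Re R) (@raddfB _ _ _) (@Re_le_cmod _).
have cIm := cvgP (@complex.Im R) (@raddfB _ _ _) (@Im_le_cmod _).
by apply: cvgD; apply: cvgM.
Qed.

Lemma rvnorm_Mk_cvg (v : 'cV[R]_m) :
  (rvnorm (v^T *m Mk A B C D N) : R^o) @[N --> \oo] -->
  (Num.sqrt ((2 * pi)^-1 *
     \int[lebesgue_measure]_(t in `[0, 2 * pi]) h2_integrand A B C D v t) : R^o).
Proof.
set f := fun N t => \sum_j ((\sum_(k < N) gain v j k * cos (k%:R * t)) ^+ 2
         + (\sum_(k < N) gain v j k * sin (k%:R * t)) ^+ 2).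
have fI N : period_integral (f N) (\sum_j (2 * pi * \sum_(k < N) gain v j k ^+ 2)).
  by apply: period_integral_sum => j; exact: period_integral_trig.
have [K fK] : exists K, forall N t, `|f N t| <= K.
  have /choice[M gM] := abs_summable_gain v.
  (* [M j] bounds the sums of the [|gain v j k|], hence in absolute value the cosine sum and the
     sine sum alike. *)
  exists (\sum_j (M j ^+ 2 + M j ^+ 2)) => N t.
  rewrite ger0_norm; last by apply: sumr_ge0 => j _; rewrite addr_ge0// sqr_ge0.
  have trigM (c : nat -> R) (j : 'I_p) : (forall k, `|c k| <= 1) ->
      (\sum_(k < N) gain v j k * c k) ^+ 2 <= M j ^+ 2.
    move=> c1; rewrite -[leLHS]real_normK ?num_real// ler_sqr ?nnegrE//; last first.
      exact: le_trans (sumr_ge0 _ (fun k _ => cmod_ge0 _)) (gM j N).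
    apply: le_trans (ler_norm_sum _ _ _) _; apply: le_trans _ (gM j N).
    by apply: ler_sum => k _; rewrite cmod_real normrM ler_piMr.
  apply: ler_sum => j _; apply: lerD; apply: (trigM (fun k => _ (k%:R * t))) => k.
    by rewrite ler_norml cos_geN1 cos_le1.
  by rewrite ler_norml sin_geN1 sin_le1.
have mD : measurable (`[0, 2 * pi]%classic : set (measurableTypeR R)) by [].
have mf N : measurable_fun (`[0, 2 * pi]%classic : set (measurableTypeR R)) (f N).
  by apply: measurable_funTS; apply: continuous_measurable_fun; case: (fI N).
have fh t : (f N t)%:E @[N --> \oo] --> (h2_integrand A B C D v t)%:E.
  apply/fine_cvgP; split; first exact: nearW.
  exact: h2_integrand_cvg.
have [|||||inth _] := @dominated_convergence _ _ _
  (@lebesgue_measure R) `[0, 2 * pi]%classic mD (fun N t => (f N t)%:E)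
  (fun t => (h2_integrand A B C D v t)%:E) (cst K%:E).
- by move=> N; apply/measurable_EFinP; exact: mf.
- apply: (emeasurable_fun_cvg (fun N t => (f N t)%:E)) => [N|t _]; last exact: fh.
  by apply/measurable_EFinP; exact: mf.
- by apply: aeW => t _; exact: fh.
- apply: (continuous_compact_integrable (@segment_compact _ _ _)).
  by apply: continuous_subspaceT => x; exact: cvg_cst.
- by apply: aeW => t N _; rewrite lee_fin; exact: fK.
under eq_fun do rewrite (period_integralE (fI _)).
(* Integrability of the limit makes its integral finite, so the convergence descends to real
   numbers. *)
rewrite -(fineK (integrable_fin_num mD inth)) => /fine_cvg cvgh.
have qE N : rvnorm (v^T *m Mk A B C D N) = Num.sqrt ((2 * pi)^-1 *
    \sum_j (2 * pi * \sum_(k < N) gain v j k ^+ 2)).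
  rewrite -big_distrr mulKf; last by rewrite mulf_neq0 ?gt_eqF ?pi_gt0.
  by rewrite -sqr_rvnorm_Mk sqrtr_sqr ger0_norm// sqrtr_ge0.
rewrite (funext qE).
have cvg2 := cvgM (cvg_cst (2 * pi)^-1) cvgh.
apply: continuous_cvg; first exact: sqrt_continuous.
exact: cvg2.
Qed.

Lemma nondecreasing_rvnorm_Mk (v : 'cV[R]_m) :
  {homo (fun N => rvnorm (v^T *m Mk A B C D N)) :
    N1 N2 / (N1 <= N2)%N >-> N1 <= N2}.
Proof.
apply: homo_leq => [//||N]; first exact: le_trans.
rewrite -ler_sqr ?nnegrE ?sqrtr_ge0// !sqr_rvnorm_Mk; apply: ler_sum => j _.
by rewrite big_ord_recr lerDl sqr_ge0.
Qed.

(** Uniformity in [v] is the point: it makes the set whose supremum is [h2opnorm] bounded. For unit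
    [v], each squared entry of [v^T M] is at most a squared column norm, and the squared entries of
    the Markov parameters are summable. *)
Lemma rvnorm_Mk_bounded :
  exists K, forall v : 'cV[R]_m, vnorm v = 1 -> forall N,
    rvnorm (v^T *m Mk A B C D N) <= K.
Proof.
have /choice[M gM] : forall ij : 'I_m * 'I_p, exists M, forall N,
    \sum_(k < N) markov_parameter k ij.1 ij.2 ^+ 2 <= M.
  move=> [i j]; have [M HM] := abs_summable_sqr (abs_summable_markov_parameter i j).
  exists M => N; apply: le_trans (HM N); apply: ler_sum => k _.
  by rewrite mxE cmod_real real_normK// num_real.
exists (Num.sqrt (\sum_j \sum_i M (i, j))) => v v1 N.
rewrite -[leLHS]ger0_norm ?sqrtr_ge0// -sqrtr_sqr ler_wsqrtr// sqr_rvnorm_Mk.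
apply: ler_sum => j _.
apply: (@le_trans _ _ (\sum_(k < N) \sum_i markov_parameter k i j ^+ 2)).
  by apply: ler_sum => k _; exact: sqr_mulmx_le_col.
by rewrite exchange_big; apply: ler_sum => i _; exact: (gM (i, j)).
Qed.

End System.

(** * Exchange of the suprema over [v] and [N] *)

Theorem lemma18 (R : realType) (n m p : nat) (A : 'M[R]_n) (B : 'M[R]_(n, p))
    (C : 'M[R]_(m, n)) (D : 'M[R]_(m, p)) :
  spectral_radius A < 1 ->
  (fun k : nat => opnorm (Mk A B C D k) : R^o) @ \oo --> (h2opnorm A B C D : R^o).
Proof.
move=> rhoA.
pose h (v : 'cV[R]_m) := Num.sqrt ((2 * pi)^-1 *
  \int[lebesgue_measure]_(t in `[0, 2 * pi]) h2_integrand A B C D v t).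
have qh v : (rvnorm (v^T *m Mk A B C D N) : R^o) @[N --> \oo] --> (h v : R^o).
  exact: rvnorm_Mk_cvg.
have le_qh v N : rvnorm (v^T *m Mk A B C D N) <= h v.
  rewrite -(cvg_lim (@norm_hausdorff _ _) (qh v)).
  apply: (nondecreasing_cvgn_le (nondecreasing_rvnorm_Mk A B C D v)).
  by apply/cvg_ex; exists (h v).
have [K qK] := rvnorm_Mk_bounded B C D rhoA.
(* The uniform bound passes to the limit in [N]. *)
have ubh : ubound [set h v | v in [set v | vnorm v = 1]] K.
  move=> _ [v /= v1 <-]; rewrite -(cvg_lim (@norm_hausdorff _ _) (qh v)).
  apply: limr_le; first by apply/cvg_ex; exists (h v).
  by apply: nearW => N; exact: qK.
have le_hh2 v : vnorm v = 1 -> h v <= h2opnorm A B C D.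
  by move=> v1; apply: ub_le_sup; [exists K|exists v].
(* for [m = 0] the unit sphere is empty and [h2opnorm] is [sup set0 = 0] *)
have h2_set0 : ~ ([set v : 'cV[R]_m | vnorm v = 1] !=set0) -> h2opnorm A B C D = 0.
  move=> noV; rewrite /h2opnorm (_ : [set v | _] = set0) ?image_set0 ?sup0//.
  by apply/seteqP; split=> // v v1; case: noV; exists v.
have h2_ge0 : 0 <= h2opnorm A B C D.
  have [[v v1]|/h2_set0->//] := pselect ([set v : 'cV[R]_m | vnorm v = 1] !=set0).
  exact: le_trans (sqrtr_ge0 _) (le_hh2 v v1).
have le_h2 N : opnorm (Mk A B C D N) <= h2opnorm A B C D.
  apply: opnorm_le => // v v1; exact: le_trans (le_qh v N) (le_hh2 v v1).
apply/cvgrPdist_lt => e e0.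
have near_h2 : \forall N \near \oo, h2opnorm A B C D - e < opnorm (Mk A B C D N).
  have [[v0 v01]|/h2_set0->] := pselect ([set v : 'cV[R]_m | vnorm v = 1] !=set0).
    (* One nearly optimal [v] suffices: [|v^T M_N|] tends to [h v > h2opnorm - e], and [opnorm]
       dominates it. *)
    have [|_ [v v1 <-] hv] := @sup_adherent _ [set h v | v in [set v | vnorm v = 1]] _ e0.
      by split; [exists (h v0), v0|exists K].
    apply: filterS (cvgr_gt _ (qh v) _ hv) => N qN.
    by apply: lt_le_trans qN _; exact: rvnorm_le_opnorm.
  by apply: nearW => N; rewrite (lt_le_trans _ (opnorm_ge0 _))// sub0r oppr_lt0.
apply: filterS near_h2 => N hN.
by rewrite ger0_norm ?subr_ge0// ltrBlDr addrC -ltrBlDr.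
Qed.
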